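(* Let $n$ be a positive integer and let $a,b$ be odd integers with $0<a<b<n/2$. There exists a self-complementary binary $(n,4n)$ code $C$ such that \[ \{i\in\{0,1,\ldots,n\}:A_i(C)\ne0\}=\{0,\ n/2\pm a,\ n/2\pm b,\ n/2,\ n\},\qquad A_{n/2}(C)=2n-2, \] and $C=C_1\cup C_2$ where each $C_i$ has distance distribution with $A_0(C_i)=1$, $A_{n/2}(C_i)=2n-2$, $A_n(C_i)=1$ and all other $A_j(C_i)=0$, if and only if there exists a pair of weakly unbiased Hadamard matrices $H,K$ of order $n$ with $\sigma(H,K)=\{2a,2b\}$.
   Context: A binary $(n,M)$ code is a subset of $\mathbb{Z}_2^n$ of size $M$; $A_i(C)=\frac{1}{|C|}|\{(x,x')\in C\times C: d(x,x')=i\}|$ with $d$ Hamming distance; $C$ is self-complementary if $x+\mathbf{1}\in C$ for all $x\in C$. A Hadamard matrix of order $n$ is an $n\times n$ $(\pm1)$-matrix $H$ with $HH^T=nI_n$. For Hadamard matrices $H,K$ with $a_{ij}$ the $(i,j)$-entry of $HK^T$, $\sigma(H,K)=\{|a_{ij}|: i,j\}$. $H,K$ are weakly unbiased if $a_{ij}\equiv 2\pmod 4$ for all $i,j$ and $|\sigma(H,K)|\le 2$, unbiased pairs (all $|a_{ij}|=\sqrt n$) being excluded, so $|\sigma(H,K)|=2$. *)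

(* Defs.v *)
From mathcomp Require Import all_boot all_order all_algebra all_field.
From mathcomp Require Import finmap.

Set Implicit Arguments.
Unset Strict Implicit.
Unset Printing Implicit Defensive.

Import Order.TTheory GRing.Theory Num.Theory.
Local Open Scope ring_scope.

Definition code (n : nat) := {set 'rV['Z_2]_n}.

Definition hamming (n : nat) (x y : 'rV['Z_2]_n) : nat :=
  #|[set i : 'I_n | x 0 i != y 0 i]|.

(* The index is rational so that A_{n/2} is meaningful for odd n as well,
   where it is 0. *)
Definition dist_distr (n : nat) (C : code n) (i : rat) : rat :=
  #|[set p in setX C C | (hamming p.1 p.2)%:R == i]|%:R / #|C|%:R.

Definition dist_support (n : nat) (C : code n) : {fset rat} :=
  [fset (i%:R : rat) | i in iota 0 n.+1 & dist_distr C i%:R != 0]%fset.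

Definition self_complementary (n : nat) (C : code n) : Prop :=
  forall x, x \in C -> x + const_mx 1 \in C.

Definition is_hadamard (n : nat) (H : 'M[int]_n) : Prop :=
  (forall i j, H i j = 1 \/ H i j = -1) /\ H *m H^T = n%:R%:M.

Definition sigma (n : nat) (H K : 'M[int]_n) : {fset int} :=
  [fset `|(H *m K^T) ij.1 ij.2| | ij : 'I_n * 'I_n]%fset.

Definition unbiased (n : nat) (H K : 'M[int]_n) : Prop :=
  [/\ is_hadamard H, is_hadamard K &
      forall i j, `|(H *m K^T) i j|%:~R = sqrtC (n%:R : algC)].

Definition weakly_unbiased (n : nat) (H K : 'M[int]_n) : Prop :=
  [/\ is_hadamard H, is_hadamard K,
      forall i j, ((H *m K^T) i j = 2 %[mod 4])%Z,
      (#|` sigma H K| <= 2)%N & ~ unbiased H K].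

Definition hadamard_distr (n : nat) (D : code n) : Prop :=
  [/\ dist_distr D 0 = 1, dist_distr D (n%:R / 2) = 2 * n%:R - 2,
      dist_distr D n%:R = 1 &
      forall j : nat, (j <= n)%N ->
        (j%:R : rat) \notin [:: 0; n%:R / 2; n%:R] -> dist_distr D j%:R = 0].

(* Main.v *)
Require Import Defs.
From mathcomp Require Import all_boot all_order all_algebra all_field.
From mathcomp Require Import finmap ring lra zify.

Set Implicit Arguments.
Unset Strict Implicit.
Unset Printing Implicit Defensive.

Import Order.TTheory GRing.Theory Num.Theory.
Local Open Scope ring_scope.

(** Replacing each bit c by (-1)^c turns the Hamming distance d(x, y) into the
    inner product n - 2 d(x, y).  A code D has the distance distribution of the
    C_i exactly when it consists of the rows of a Hadamard matrix and their
    negatives: A_0 + A_(n/2) + A_n = 2n = |D|, A_n = 1 says that D is closed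
    under complement, and one word from each complementary pair gives a row.
    If C is the union of two such codes, coming from H and K, the pairs at
    distance n/2 inside the C_i already account for A_(n/2)(C) = 2n - 2, so no
    cross pair is at distance n/2, and the other cross distances n/2 -+ a,
    n/2 -+ b correspond to the entries +-2a, +-2b of H K^T. *)

(** * Bits as signs *)

(** The nontrivial character of ['Z_2]; the residue is read as the exponent 0 or 1. *)
Definition sgn2 (c : 'Z_2) : int := (-1) ^+ c.

Lemma Z2P (c : 'Z_2) : c = 0 \/ c = 1.
Proof. by case: c => [[|[|//]] ?]; [left|right]; apply: val_inj. Qed.

Lemma sgn2D (c d : 'Z_2) : sgn2 (c + d) = sgn2 c * sgn2 d.
Proof. by case: (Z2P c) => ->; case: (Z2P d) => ->. Qed.

Lemma sgn2_pm (c : 'Z_2) : sgn2 c = 1 \/ sgn2 c = -1.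
Proof. by case: (Z2P c) => ->; [left|right]. Qed.

(** The bit [e != 1] encodes the sign [e]; this decodes the entries of [hadamard_word]. *)
Lemma sgn2_indicator (c : 'Z_2) (e : int) : e = 1 \/ e = -1 ->
  sgn2 ((e != 1)%:R + c) = e * sgn2 c.
Proof. by rewrite sgn2D => -[] ->. Qed.

(** * Hamming distance as an inner product of sign vectors *)

Section Words.
Variable n : nat.
Implicit Types x y : 'rV['Z_2]_n.

Definition sgn_dot x y : int := \sum_j sgn2 (x 0 j) * sgn2 (y 0 j).

(** A coordinate contributes 1 where the words agree and -1 where they differ. *)
Lemma sgn_dotE x y : sgn_dot x y = n%:R - 2 * (hamming x y)%:R.
Proof.
rewrite /sgn_dot (eq_bigr (fun j => 1 - 2 * (x 0 j != y 0 j)%:R)); last first.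
  by move=> j _; case: (Z2P (x 0 j)) => ->; case: (Z2P (y 0 j)) => ->.
rewrite sumrB sumr_const card_ord -mulr_sumr; congr (_ - 2 * _).
by rewrite /hamming -sum1_card natr_sum [RHS]big_mkcond /=; apply: eq_bigr => j _;
  rewrite inE; case: (_ != _).
Qed.

Lemma hammingE x y :
  (hamming x y)%:R = n%:R / 2 - (sgn_dot x y)%:~R / 2 :> rat.
Proof. by rewrite sgn_dotE rmorphB rmorphM /= !rmorph_nat; field. Qed.

Lemma hamming_le x y : (hamming x y <= n)%N.
Proof. by rewrite -[X in (_ <= X)%N]card_ord max_card. Qed.

Lemma hamming_eq0 x y : (hamming x y == 0)%N = (x == y).
Proof.
rewrite cards_eq0; apply/eqP/eqP => [h|->]; last first.
  by apply/setP => j; rewrite !inE eqxx.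
apply/rowP => j; move/setP/(_ j): h; rewrite !inE.
by move/negbFE/eqP.
Qed.

Lemma sgn_dotC x y : sgn_dot x y = sgn_dot y x.
Proof. by apply: eq_bigr => j _; rewrite mulrC. Qed.

Lemma hammingC x y : hamming x y = hamming y x.
Proof. by apply: eq_card => j; rewrite !inE eq_sym. Qed.

Lemma sgn_dotDl x y c : sgn_dot (x + const_mx c) y = sgn2 c * sgn_dot x y.
Proof.
rewrite /sgn_dot mulr_sumr; apply: eq_bigr => j _.
by rewrite !mxE sgn2D [sgn2 _ * sgn2 c]mulrC mulrA.
Qed.

Lemma sgn_dotDr x y c : sgn_dot x (y + const_mx c) = sgn2 c * sgn_dot x y.
Proof. by rewrite sgn_dotC sgn_dotDl sgn_dotC. Qed.

Lemma sgn_dot_eqn x y : (sgn_dot x y == n%:R) = (x == y).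
Proof.
rewrite -hamming_eq0 sgn_dotE; apply/eqP/eqP; lia.
Qed.

Lemma compl_rowK x : x + const_mx 1 + const_mx 1 = x.
Proof. by apply/rowP => j; rewrite !mxE; case: (Z2P (x 0 j)) => ->; apply: val_inj. Qed.

(** Complementing [x] negates the inner product, so distance [n] from [x] is distance 0 from its
    complement. *)
Lemma hamming_eqn x y : (hamming x y == n) = (y == x + const_mx 1).
Proof.
rewrite [RHS]eq_sym -[RHS]sgn_dot_eqn sgn_dotDl sgn_dotE /sgn2 /= expr1.
by apply/eqP/eqP; lia.
Qed.

(** * Counting pairs of codewords at a given distance *)

Definition dist_pairs (D : code n) (i : rat) :=
  [set p in setX D D | (hamming p.1 p.2)%:R == i].

Lemma mem_dist_pairs (D : code n) i x y :
  ((x, y) \in dist_pairs D i) = [&& x \in D, y \in D & (hamming x y)%:R == i].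
Proof. by rewrite !inE andbA. Qed.

Lemma dist_distrE (D : code n) i : dist_distr D i = #|dist_pairs D i|%:R / #|D|%:R.
Proof. by []. Qed.

Lemma card_dist_pairsP (D : code n) i (k : rat) : (0 < #|D|)%N ->
  dist_distr D i = k <-> #|dist_pairs D i|%:R = k * #|D|%:R.
Proof.
move=> D0; rewrite dist_distrE.
have D0' : (#|D|%:R : rat) != 0 by rewrite pnatr_eq0 -lt0n.
by split=> [<-|->]; rewrite ?divfK ?mulfK.
Qed.

(** The empty code is covered too: there the quotient is 0 / 0 = 0 and no pair exists. *)
Lemma dist_distr_neq0 (D : code n) i :
  dist_distr D i != 0 <->
  exists x y, [/\ x \in D, y \in D & (hamming x y)%:R = i].
Proof.
split=> [h|[x [y [xD yD e]]]].
  have : dist_pairs D i != set0.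
    by apply: contra_neq h; rewrite dist_distrE => ->; rewrite cards0 mul0r.
  by case/set0Pn => -[x y]; rewrite mem_dist_pairs => /and3P[? ? /eqP ?]; exists x, y.
rewrite dist_distrE mulf_neq0 ?invr_neq0 // pnatr_eq0 -lt0n card_gt0; apply/set0Pn.
  by exists (x, y); rewrite mem_dist_pairs xD yD e eqxx.
by exists x.
Qed.

Lemma mem_dist_support (D : code n) i :
  i \in dist_support D <->
  exists x y, [/\ x \in D, y \in D & (hamming x y)%:R = i].
Proof.
rewrite -dist_distr_neq0; split=> [/imfsetP[k /=]|h].
  by rewrite !inE => /andP[_ h] ->.
have [x [y [_ _ e]]] := (dist_distr_neq0 D i).1 h.
apply/imfsetP; exists (hamming x y); last by [].
by rewrite inE -[iota 0 n.+1]/(index_iota 0 n.+1) mem_index_iota ltnS hamming_le e.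
Qed.

Lemma card_dist_pairs0 (D : code n) : #|dist_pairs D 0| = #|D|.
Proof.
rewrite -(card_imset (mem D) (f := fun x => (x, x))) => [|x y []//].
apply: eq_card => -[x y]; rewrite mem_dist_pairs pnatr_eq0 hamming_eq0.
apply/and3P/imsetP => [[xD _ /eqP <-]|[z zD [-> ->]]]; first by exists x.
by rewrite zD.
Qed.

Lemma card_dist_pairsn (D : code n) :
  #|dist_pairs D n%:R| = #|[set x in D | x + const_mx 1 \in D]|.
Proof.
rewrite -(card_imset (mem [set x in D | _]) (f := fun x => (x, x + const_mx 1))) => [|x y []//].
apply: eq_card => -[x y]; rewrite mem_dist_pairs eqr_nat hamming_eqn.
apply/and3P/imsetP => [[xD yD /eqP e]|[z + [-> ->]]].
  by exists x; rewrite ?inE ?xD -?e.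
by rewrite inE => /andP[-> ->].
Qed.

(** For [n > 0] the three distances are distinct, so the three sets of pairs partition [D] times
    [D]. *)
Lemma card_dist_pairs_sum (D : code n) : (0 < n)%N ->
  (forall x y, x \in D -> y \in D ->
     ((hamming x y)%:R : rat) \in [:: 0; n%:R / 2; n%:R]) ->
  (#|dist_pairs D 0| + #|dist_pairs D (n%:R / 2)| + #|dist_pairs D n%:R|)%N =
  (#|D| * #|D|)%N.
Proof.
move=> n0 hD.
have n0' : (0 : rat) < n%:R by rewrite ltr0n.
have disj i j : i != j -> dist_pairs D i :&: dist_pairs D j = set0.
  move=> ij; apply/setP => p; rewrite !inE; apply/negP.
  by case/andP => /andP[_ /eqP ->] /andP[_ /eqP e]; rewrite e eqxx in ij.
rewrite -cardsX -cardsUI disj ?cards0 ?addn0; last by lra.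
rewrite -[LHS]cardsUI setIUl !disj ?setU0 ?cards0 ?addn0; [|lra|lra].
apply: eq_card => -[x y]; rewrite in_setU in_setU !mem_dist_pairs in_setX.
have [xD|] := boolP (x \in D); have [yD|] := boolP (y \in D) => //=.
by move: (hD _ _ xD yD); rewrite !inE orbA.
Qed.

(** * The code of a Hadamard matrix *)

(* Row i of H as a binary word, with -1 encoded by 1; c = 1 negates it. *)
Definition hadamard_word (H : 'M[int]_n) (ic : 'I_n * 'Z_2) : 'rV['Z_2]_n :=
  \row_j (H ic.1 j != 1)%:R + const_mx ic.2.

Definition hadamard_code (H : 'M[int]_n) : code n :=
  [set hadamard_word H ic | ic : 'I_n * 'Z_2].

Lemma hadamard_codeP (H : 'M[int]_n) x :
  reflect (exists i c, x = hadamard_word H (i, c)) (x \in hadamard_code H).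
Proof.
by apply: (iffP imsetP) => [[[i c] _ ->]|[i [c ->]]]; [exists i, c|exists (i, c)].
Qed.

Lemma mem_hadamard_word H i c : hadamard_word H (i, c) \in hadamard_code H.
Proof. by apply/hadamard_codeP; exists i, c. Qed.

Lemma hadamard_wordD H i c d :
  hadamard_word H (i, c) + const_mx d = hadamard_word H (i, c + d).
Proof. by apply/rowP => j; rewrite !mxE addrA. Qed.

Lemma hadamard_code_compl H : self_complementary (hadamard_code H).
Proof.
by move=> x /hadamard_codeP[i [c ->]]; rewrite hadamard_wordD mem_hadamard_word.
Qed.

(** The bits [c] and [d] factor out as signs; what remains is row [i] of [H] against row [j] of
    [K]. *)
Lemma sgn_dot_hadamard (H K : 'M[int]_n) i j c d :
  is_hadamard H -> is_hadamard K ->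
  sgn_dot (hadamard_word H (i, c)) (hadamard_word K (j, d)) =
  sgn2 c * sgn2 d * (H *m K^T) i j.
Proof.
move=> [hH _] [hK _]; rewrite /hadamard_word sgn_dotDl sgn_dotDr mulrA /=.
congr (_ * _); rewrite mxE; apply: eq_bigr => k _; rewrite !mxE.
by rewrite -[X in sgn2 X]addr0 sgn2_indicator // -[X in _ * sgn2 X]addr0
  sgn2_indicator //= !mulr1.
Qed.

Lemma hadamard_mul_tr (H : 'M[int]_n) i j : is_hadamard H ->
  (H *m H^T) i j = n%:R *+ (i == j).
Proof. by case=> _ ->; rewrite mxE. Qed.

Hypothesis n_gt0 : (0 < n)%N.

(** Equal words have inner product [n > 0], whereas distinct rows give 0 and a row with its negative
    gives [-n]; hence the encoding is injective. *)
Lemma card_hadamard_code H : is_hadamard H -> #|hadamard_code H| = (2 * n)%N.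
Proof.
move=> hH; rewrite card_imset; first by rewrite card_prod !card_ord mulnC.
move=> [i c] [j d] /eqP; rewrite -sgn_dot_eqn sgn_dot_hadamard //.
rewrite hadamard_mul_tr //; case: (eqVneq i j) => [->|_] /eqP; last first.
  by rewrite mulr0; lia.
rewrite mulr1n.
by case: (Z2P c) => ->; case: (Z2P d) => -> //; rewrite /sgn2 /= expr0 expr1; lia.
Qed.

Lemma hadamard_code_sgn_dot H x y : is_hadamard H ->
  x \in hadamard_code H -> y \in hadamard_code H ->
  sgn_dot x y \in [:: 0; n%:R; - n%:R].
Proof.
move=> hH /hadamard_codeP[i [c ->]] /hadamard_codeP[j [d ->]].
rewrite sgn_dot_hadamard // hadamard_mul_tr //; case: eqP => _ /=; last first.
  by rewrite mulr0 inE eqxx.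
by rewrite !inE; case: (sgn2_pm c) => ->; case: (sgn2_pm d) => ->;
  rewrite ?mulNr !mul1r ?opprK eqxx ?orbT.
Qed.

Lemma hadamard_code_hamming H x y : is_hadamard H ->
  x \in hadamard_code H -> y \in hadamard_code H ->
  ((hamming x y)%:R : rat) \in [:: 0; n%:R / 2; n%:R].
Proof.
move=> hH xH yH; have := hadamard_code_sgn_dot hH xH yH.
rewrite !inE hammingE => /or3P[] /eqP ->; apply/or3P;
  [apply: Or32|apply: Or31|apply: Or33]; apply/eqP; rewrite ?rmorphN ?rmorph_nat; lra.
Qed.

Lemma hadamard_code_distr H : is_hadamard H -> hadamard_distr (hadamard_code H).
Proof.
move=> hH; have D2 := card_hadamard_code hH.
have D0 : (0 < #|hadamard_code H|)%N by lia.
have N0 := card_dist_pairs0 (hadamard_code H).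
have Nn : #|dist_pairs (hadamard_code H) n%:R| = #|hadamard_code H|.
  rewrite card_dist_pairsn; apply: eq_card => x; rewrite inE.
  by case: (boolP (x \in _)) => // /hadamard_code_compl ->.
have := card_dist_pairs_sum n_gt0
  (fun x y hx hy => hadamard_code_hamming hH hx hy).
rewrite N0 Nn => sum.
split; try (apply/card_dist_pairsP => //).
- by rewrite N0 mul1r.
(* By subtraction: of the [(2n)^2] pairs, [2n] are at distance 0 and [2n] at distance [n]. *)
- have -> : #|dist_pairs (hadamard_code H) (n%:R / 2)| = ((2 * n - 2) * (2 * n))%N by nia.
  rewrite D2 natrM natrB; last by lia.
  by rewrite !natrM.
- by rewrite Nn mul1r.
- move=> j _ hj; apply/eqP; apply: contraNT hj.
  by move/dist_distr_neq0 => [x [y [hx hy <-]]]; apply: hadamard_code_hamming hH hx hy.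
Qed.

(** * Recovering a Hadamard matrix from the distance distribution *)

Lemma hadamard_distr_code (D : code n) : hadamard_distr D ->
  exists H, is_hadamard H /\ D = hadamard_code H.
Proof.
case=> d0 dh dn dj.
have D0 : (0 < #|D|)%N.
  rewrite lt0n; apply/eqP => e; move: d0.
  by rewrite dist_distrE e invr0 mulr0 => /eqP; rewrite eq_sym oner_eq0.
have hD x y : x \in D -> y \in D ->
    ((hamming x y)%:R : rat) \in [:: 0; n%:R / 2; n%:R].
  move=> xD yD; case: (boolP (_ \in _)) => // /(dj _ (hamming_le x y)) /eqP.
  by apply: contraLR => _; apply/dist_distr_neq0; exists x, y.
(* The pair counts add up to [#|D|^2 = (1 + (2n - 2) + 1) * #|D|]; cancel [#|D|]. *)
have D2 : #|D| = (2 * n)%N.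
  have := card_dist_pairs_sum n_gt0 hD.
  move/card_dist_pairsP: d0 => /(_ D0) e0.
  move/card_dist_pairsP: dh => /(_ D0) eh.
  move/card_dist_pairsP: dn => /(_ D0) en.
  move/(congr1 (fun k => k%:R : rat)); rewrite !natrD e0 eh en natrM => e.
  have D0' : (#|D|%:R : rat) != 0 by rewrite pnatr_eq0 -lt0n.
  apply/eqP; rewrite -(eqr_nat rat) natrM -(inj_eq (mulIf D0')) -e.
  by apply/eqP; ring.
(* [A_n = 1] says that the words with complement in [D] are as many as all words of [D]. *)
have Dc x : x \in D -> x + const_mx 1 \in D.
  move/card_dist_pairsP: dn => /(_ D0); rewrite mul1r card_dist_pairsn.
  move/eqP; rewrite eqr_nat => /eqP e xD.
  have : [set x in D | x + const_mx 1 \in D] = D.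
    by apply/eqP; rewrite eqEcard e leqnn andbT; apply/subsetP => z; rewrite inE => /andP[].
  by move/setP/(_ x); rewrite inE xD.
(* The words of D vanishing at i0 represent its complementary pairs. *)
pose i0 := Ordinal n_gt0.
pose D' := [set x in D | x 0 i0 == 0].
have cD' : #|D'| = n.
  have : #|D| = (#|D'| + #|D'|)%N.
    (* Complementation flips the bit at [i0], so it maps [D'] bijectively onto [D :\: D']. *)
    rewrite -[X in (_ + X)%N](card_imset (mem D') (f := fun x => x + const_mx 1)); last first.
      exact: addIr.
    rewrite -(cardsID D' D); congr (_ + _)%N.
      by apply: eq_card => x; rewrite !inE andbA andbb.
    apply: eq_card => x; rewrite !inE; apply/andP/imsetP => [[+ xD]|[z + ->]].
      rewrite xD /= => xi; exists (x + const_mx 1); last by rewrite compl_rowK.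
      by rewrite inE Dc // !mxE; case: (Z2P (x 0 i0)) xi => ->.
    by rewrite inE => /andP[/Dc -> /eqP zi]; rewrite !mxE zi.
  by rewrite D2; lia.
pose e i := enum_val (cast_ord (esym cD') i).
have eD' i : e i \in D' by exact: enum_valP.
have eD i : e i \in D by move: (eD' i); rewrite inE => /andP[].
pose H := \matrix_(i, j) sgn2 (e i 0 j).
have Hpm i j : H i j = 1 \/ H i j = -1 by rewrite mxE; exact: sgn2_pm.
have hH : is_hadamard H.
  split=> //; apply/matrixP => i k; rewrite !mxE.
  transitivity (sgn_dot (e i) (e k)); first by apply: eq_bigr => j _; rewrite !mxE.
  case: (eqVneq i k) => [->|ik]; first by apply/eqP; rewrite sgn_dot_eqn.
  (* Distance 0 would force [i = k]; distance [n] would make the bits at [i0] differ, but both are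
     0. The remaining distance [n/2] is orthogonality. *)
  have := hD _ _ (eD i) (eD k); rewrite !inE pnatr_eq0 hamming_eq0 eqr_nat hamming_eqn.
  case/or3P => /eqP h.
  - by move/enum_val_inj/cast_ord_inj: h ik => ->; rewrite eqxx.
  - move: h; rewrite hammingE => h; apply/eqP; rewrite -(intr_eq0 rat) ; lra.
  - move: (eD' i) (eD' k); rewrite !inE h !mxE => /andP[_ /eqP ->].
    by rewrite add0r andbF.
exists H; split=> //; apply/esym/eqP.
(* Both codes have [2n] words, so one inclusion suffices. *)
rewrite eqEcard D2 card_hadamard_code // leqnn andbT.
apply/subsetP => x /hadamard_codeP[i [c ->]].
have -> : hadamard_word H (i, c) = e i + const_mx c.
  apply/rowP => j; rewrite !mxE; congr (_ + _).
  by case: (Z2P (e i 0 j)) => ->; apply: val_inj.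
case: (Z2P c) => ->; last exact: Dc.
by rewrite (_ : _ + _ = e i) //; apply/rowP => j; rewrite !mxE addr0.
Qed.

End Words.

(** * Unions of two codes *)

(** Since [s] may be negative or 0, one statement serves the distances [n/2 - t], [n/2 + t] and
    [n/2]. *)
Lemma hamming_sgn_dot n (x y : 'rV['Z_2]_n) (s : int) :
  (hamming x y)%:R = n%:R / 2 - s%:~R :> rat <-> sgn_dot x y = 2 * s.
Proof.
rewrite hammingE; split=> [h|->]; last by rewrite rmorphM /=; field.
have: (sgn_dot x y)%:~R = (2 * s)%:~R :> rat by rewrite rmorphM /=; lra.
by move/eqP; rewrite eqr_int => /eqP.
Qed.

Lemma dist_pairs_setU n (C1 C2 : code n) i :
  dist_pairs C1 i :|: dist_pairs C2 i \subset dist_pairs (C1 :|: C2) i.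
Proof.
apply/subsetP => -[x y]; rewrite in_setU !mem_dist_pairs !in_setU.
by case/orP => /and3P[-> -> ->]; rewrite ?orbT.
Qed.

Lemma card_dist_pairs_setU n (C1 C2 : code n) i : [disjoint C1 & C2] ->
  #|dist_pairs C1 i :|: dist_pairs C2 i| =
  (#|dist_pairs C1 i| + #|dist_pairs C2 i|)%N.
Proof.
move=> dis; apply/eqP; rewrite (eq_leqif (leq_card_setU _ _)).
apply/pred0P => -[x y] /=; apply/negP => /andP[].
rewrite !mem_dist_pairs => /and3P[x1 _ _] /and3P[x2 _ _].
by move/pred0P/(_ x): dis; rewrite /= x1 x2.
Qed.

(** The pairs inside [C1] and inside [C2] already number [k * #|C1 :|: C2|], so the union has the
    value [k] exactly when cross pairs contribute nothing. *)
Lemma dist_distr_setU n (C1 C2 : code n) i (k : rat) :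
  (0 < #|C1|)%N -> #|C1| = #|C2| -> [disjoint C1 & C2] ->
  dist_distr C1 i = k -> dist_distr C2 i = k ->
  dist_distr (C1 :|: C2) i = k <->
  (forall x y, x \in C1 -> y \in C2 -> (hamming x y)%:R != i).
Proof.
move=> C0 e12 dis d1 d2.
have cU : #|C1 :|: C2| = (#|C1| + #|C2|)%N.
  by apply/eqP; rewrite (eq_leqif (leq_card_setU _ _)).
have k1 : #|dist_pairs C1 i|%:R = k * #|C1|%:R by apply/card_dist_pairsP.
have k2 : #|dist_pairs C2 i|%:R = k * #|C2|%:R.
  by apply/card_dist_pairsP; rewrite -?e12.
rewrite card_dist_pairsP; last by rewrite cU; lia.
have -> : k * #|C1 :|: C2|%:R = #|dist_pairs C1 i :|: dist_pairs C2 i|%:R.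
  by rewrite card_dist_pairs_setU // cU !natrD k1 k2; ring.
have sub := dist_pairs_setU C1 C2 i.
split=> [/eqP|h].
  rewrite eqr_nat => /eqP e x y xC yC; apply/negP => exy.
  have : dist_pairs C1 i :|: dist_pairs C2 i = dist_pairs (C1 :|: C2) i.
    by apply/eqP; rewrite eqEcard sub e leqnn.
  move/setP/(_ (x, y)); rewrite in_setU !mem_dist_pairs !in_setU xC yC exy orbT.
  by rewrite (disjointFr dis xC) (disjointFl dis yC).
congr (_%:R); apply: eq_card => -[x y]; apply/idP/idP; last exact/subsetP.
rewrite in_setU !mem_dist_pairs !in_setU => /and3P[].
case/orP=> xC /orP[] yC exy; rewrite ?xC ?yC ?exy ?orbT //.
  by case/negP: (h _ _ xC yC).
by case/negP: (h _ _ yC xC); rewrite hammingC.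
Qed.

(** * Codes and weakly unbiased pairs *)

Theorem theorem7p1 (n a b : nat) (hn : (0 < n)%N)
    (odd_a : odd a) (odd_b : odd b) (ha : (0 < a)%N) (hab : (a < b)%N)
    (hb : (b%:R : rat) < n%:R / 2) :
  (exists C : code n,
     [/\ #|C| = (4 * n)%N,
         self_complementary C,
         dist_support C =
           [fset 0%R; (n%:R / 2 - a%:R)%R; (n%:R / 2 + a%:R)%R;
                 (n%:R / 2 - b%:R)%R; (n%:R / 2 + b%:R)%R; (n%:R / 2)%R; n%:R%R]%fset,
         dist_distr C (n%:R / 2) = 2 * n%:R - 2 &
         exists C1 C2 : code n,
           [/\ C = C1 :|: C2, hadamard_distr C1 & hadamard_distr C2]])
  <->
  (exists H K : 'M[int]_n,
     weakly_unbiased H K /\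
     sigma H K = [fset (2 * a%:Z)%R; (2 * b%:Z)%R]%fset).
Proof.
have hbn : (2 * b < n)%N.
  by rewrite -(ltr_nat rat) natrM; lra.
split=> [[C [cC compC supC dC [C1 [C2 [eC]]]]]|[H [K [[hH hK h4 _ _] sHK]]]].
- move=> d1 d2.
  have [H [hH eH]] := hadamard_distr_code hn d1.
  have [K [hK eK]] := hadamard_distr_code hn d2.
  have c1 : #|C1| = (2 * n)%N by rewrite eH card_hadamard_code.
  have c2 : #|C2| = (2 * n)%N by rewrite eK card_hadamard_code.
  (* The union has [4n = 2n + 2n] words, which leaves no room for an overlap. *)
  have dis : [disjoint C1 & C2].
    by rewrite -(eq_leqif (leq_card_setU _ _)) -eC cC c1 c2; apply/eqP; lia.
  have cross : forall x y, x \in C1 -> y \in C2 -> (hamming x y)%:R != n%:R / 2 :> rat.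
    apply: (dist_distr_setU _ _ dis _ _).1; rewrite ?c1 ?c2 -?eC; try exact: dC.
    + by lia.
    + by [].
    + by case: d1.
    + by case: d2.
  have sup x y : x \in C -> y \in C -> (hamming x y)%:R \in dist_support C.
    by move=> xC yC; apply/mem_dist_support; exists x, y.
  have vals i j : `|(H *m K^T) i j| \in [fset 2 * a%:Z; 2 * b%:Z]%fset.
    set x := hadamard_word H (i, 0); set y := hadamard_word K (j, 0).
    have xC1 : x \in C1 by rewrite eH mem_hadamard_word.
    have yC2 : y \in C2 by rewrite eK mem_hadamard_word.
    have exy : sgn_dot x y = (H *m K^T) i j.
      by rewrite sgn_dot_hadamard // mulr1 mul1r.
    have : (hamming x y)%:R \in dist_support C.
      by apply: sup; rewrite eC in_setU ?xC1 ?yC2 ?orbT.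
    rewrite supC !inE -exy -!orbA.
    (* Of the seven distances, 0 is excluded by disjointness, [n] by closure of [C1] under
       complement and [n/2] by [cross]; the four left give the entries [2a], [-2a], [2b], [-2b]. *)
    have/negPf -> : (hamming x y)%:R != 0 :> rat.
      rewrite pnatr_eq0 hamming_eq0; apply/eqP => e.
      by rewrite -e (disjointFr dis xC1) in yC2.
    have/negPf -> : (hamming x y)%:R != n%:R :> rat.
      rewrite eqr_nat hamming_eqn; apply/eqP => e.
      have : y \in C1 by rewrite e eH hadamard_code_compl // -eH.
      by rewrite (disjointFl dis yC2).
    have/negPf -> := cross _ _ xC1 yC2.
    rewrite !orbF /= => /or4P[] /eqP e.
    + have -> : sgn_dot x y = 2 * a%:Z by apply/hamming_sgn_dot; rewrite e.
      by apply/orP; left; apply/eqP; lia.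
    + have -> : sgn_dot x y = 2 * (- a%:Z).
        by apply/hamming_sgn_dot; rewrite e rmorphN opprK.
      by apply/orP; left; apply/eqP; lia.
    + have -> : sgn_dot x y = 2 * b%:Z by apply/hamming_sgn_dot; rewrite e.
      by apply/orP; right; apply/eqP; lia.
    + have -> : sgn_dot x y = 2 * (- b%:Z).
        by apply/hamming_sgn_dot; rewrite e rmorphN opprK.
      by apply/orP; right; apply/eqP; lia.
  (* A pair with inner product [2t], where [0 < 2t < n], cannot lie in one Hadamard code, whose
     inner products are 0, [n] and [-n]. So it is a cross pair and yields an entry of absolute value
     [2t]. *)
  have attained (t : nat) : (0 < t)%N -> (2 * t < n)%N ->
      n%:R / 2 - t%:R \in dist_support C -> exists i j, `|(H *m K^T) i j| = 2 * t%:Z.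
    move=> t0 tn /mem_dist_support[x [y [xC yC]]].
    move/(hamming_sgn_dot x y t%:Z) => exy.
    have crossed u v : u \in C1 -> v \in C2 -> sgn_dot u v = 2 * t%:Z ->
        exists i j, `|(H *m K^T) i j| = 2 * t%:Z.
      rewrite eH eK => /hadamard_codeP[i [c ->]] /hadamard_codeP[j [d ->]].
      rewrite sgn_dot_hadamard // => e; exists i, j; move: e.
      by case: (sgn2_pm c) => ->; case: (sgn2_pm d) => ->; lia.
    have same (G : 'M_n) u v : is_hadamard G -> u \in hadamard_code G -> v \in hadamard_code G ->
        sgn_dot u v = 2 * t%:Z -> False.
      move=> hG uG vG e; have := hadamard_code_sgn_dot hG uG vG.
      by rewrite e !inE => /or3P[] /eqP; lia.
    move: xC yC; rewrite eC !in_setU => /orP[] xC /orP[] yC.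
    + by rewrite eH in xC yC; case: (same _ _ _ hH xC yC exy).
    + exact: crossed exy.
    + by rewrite sgn_dotC in exy; exact: crossed exy.
    + by rewrite eK in xC yC; case: (same _ _ _ hK xC yC exy).
  have [ia [ja za]] : exists i j, `|(H *m K^T) i j| = 2 * a%:Z.
    by apply: attained; rewrite ?supC ?inE ?eqxx ?orbT //; lia.
  have [ib [jb zb]] : exists i j, `|(H *m K^T) i j| = 2 * b%:Z.
    by apply: attained; rewrite ?supC ?inE ?eqxx ?orbT //; lia.
  have sHK : sigma H K = [fset 2 * a%:Z; 2 * b%:Z]%fset.
    apply/fsetP => z; apply/imfsetP/idP => [[[i j] _ ->]|]; first exact: vals.
    by rewrite !inE => /orP[] /eqP ->; [exists (ia, ja)|exists (ib, jb)].
  exists H, K; split=> //; split=> //.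
  (* Twice an odd integer of either sign is 2 modulo 4. *)
  + move=> i j; have := vals i j; rewrite !inE.
    by move: odd_a odd_b => oa ob; lia.
  + by rewrite sHK cardfs2; case: eqP.
  (* Unbiasedness would make both [2a] and [2b] equal to the square root of [n]. *)
  + case=> _ _ unb; have := unb ia ja; rewrite -(unb ib jb) za zb.
    by move/eqP; rewrite eqr_int; lia.
- have vals i j : `|(H *m K^T) i j| = 2 * a%:Z \/ `|(H *m K^T) i j| = 2 * b%:Z.
    have : `|(H *m K^T) i j| \in sigma H K by apply/imfsetP; exists (i, j).
    by rewrite sHK !inE => /orP[] /eqP; [left|right].
  have crossP x y : x \in hadamard_code H -> y \in hadamard_code K ->
      exists t : nat, (t == a) || (t == b) /\ `|sgn_dot x y| = 2 * t%:Z.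
    move=> /hadamard_codeP[i [c ->]] /hadamard_codeP[j [d ->]].
    rewrite sgn_dot_hadamard //.
    have -> : `|sgn2 c * sgn2 d * (H *m K^T) i j| = `|(H *m K^T) i j|.
      by case: (sgn2_pm c) => ->; case: (sgn2_pm d) => ->; lia.
    by case: (vals i j) => ->; [exists a|exists b]; rewrite eqxx ?orbT.
  have cH := card_hadamard_code hn hH.
  have cK := card_hadamard_code hn hK.
  (* A common word has inner product [n] with itself, but cross inner products are at most [2b < n]
     in absolute value. *)
  have dis : [disjoint hadamard_code H & hadamard_code K].
    apply/pred0P => x /=; apply/negP => /andP[xH xK].
    have [t [tab]] := crossP _ _ xH xK.
    have /eqP -> : sgn_dot x x == n%:R by rewrite sgn_dot_eqn.
    by case/orP: tab => /eqP ->; lia.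
  have dH := hadamard_code_distr hn hH.
  have dK := hadamard_code_distr hn hK.
  have dU : dist_distr (hadamard_code H :|: hadamard_code K) (n%:R / 2) = 2 * n%:R - 2.
    apply/(dist_distr_setU _ _ dis _ _).
    + by rewrite cH; lia.
    + by rewrite cH.
    + by case: dH.
    + by case: dK.
    (* Distance [n/2 - 0] means inner product 0, while cross inner products have absolute value [2a]
       or [2b]. *)
    move=> x y xH yK; apply/eqP; rewrite -[_ / _]subr0.
    move/(hamming_sgn_dot x y 0) => e.
    by have [t [tab]] := crossP _ _ xH yK; rewrite e; case/orP: tab => /eqP ->; lia.
  exists (hadamard_code H :|: hadamard_code K); split=> //.
  + have /eqP -> : #|hadamard_code H :|: hadamard_code K| ==
        (#|hadamard_code H| + #|hadamard_code K|)%N.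
      by rewrite (eq_leqif (leq_card_setU _ _)).
    by rewrite cH cK; lia.
  + move=> x; rewrite !in_setU => /orP[] xC.
      by rewrite hadamard_code_compl.
    by rewrite (hadamard_code_compl xC) orbT.
  + pose C := hadamard_code H :|: hadamard_code K.
    set S := [fset _; _; _; _; _; _; _]%fset.
    have same (G : 'M_n) x y : is_hadamard G -> x \in hadamard_code G -> y \in hadamard_code G ->
        ((hamming x y)%:R : rat) \in S.
      move=> hG xG yG; have := hadamard_code_hamming hG xG yG.
      by rewrite !inE => /or3P[] ->; rewrite ?orbT.
    have crossed x y : x \in hadamard_code H -> y \in hadamard_code K ->
        ((hamming x y)%:R : rat) \in S.
      move=> xH yK; have [t [tab zt]] := crossP _ _ xH yK.
      have : sgn_dot x y = 2 * t%:Z \/ sgn_dot x y = 2 * (- t%:Z) by lia.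
      case=> /hamming_sgn_dot ->; rewrite ?rmorphN ?opprK.
        by case/orP: tab => /eqP ->; rewrite !inE eqxx ?orbT.
      by case/orP: tab => /eqP ->; rewrite !inE eqxx ?orbT.
    have attained (s : int) : 2 * `|s| \in sigma H K -> n%:R / 2 - s%:~R \in dist_support C.
      case/imfsetP => -[i j] _ /= e; apply/mem_dist_support.
      have {}e : 2 * `|s| = `|(H *m K^T) i j| by [].
      (* The entry is [2s] up to sign; the bit [d] complements the word from [K] when the sign is
         wrong. *)
      have : exists d, sgn2 d * (H *m K^T) i j = 2 * s.
        have : (H *m K^T) i j = 2 * s \/ (H *m K^T) i j = - (2 * s) by lia.
        by case=> ->; [exists 0; rewrite mul1r|exists 1; rewrite mulN1r opprK].
      case=> d ed; exists (hadamard_word H (i, 0)), (hadamard_word K (j, d)).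
      split; rewrite ?in_setU ?mem_hadamard_word ?orbT //.
      by apply/hamming_sgn_dot; rewrite sgn_dot_hadamard // mul1r.
    have sa : 2 * `|a%:Z| \in sigma H K by rewrite sHK !inE eqxx.
    have sb : 2 * `|b%:Z| \in sigma H K by rewrite sHK !inE eqxx orbT.
    have x0C : hadamard_word H (Ordinal hn, 0) \in C by rewrite in_setU mem_hadamard_word.
    apply/fsetP => i; apply/idP/idP.
      move/mem_dist_support => [x [y []]]; rewrite !in_setU.
      case/orP=> xC /orP[] yC <-.
      * exact: (same H).
      * exact: crossed.
      * by rewrite hammingC; exact: crossed.
      * exact: (same K).
    rewrite !inE -!orbA => /or4P[/eqP->|/eqP->|/eqP->|].
    * apply/mem_dist_support; exists (hadamard_word H (Ordinal hn, 0)), (hadamard_word H (Ordinal hn, 0)).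
      by split=> //; apply/eqP; rewrite pnatr_eq0 hamming_eq0.
    * exact: (attained a%:Z).
    * by have := attained (- a%:Z); rewrite normrN rmorphN opprK; apply.
    case/or4P => /eqP->.
    * exact: (attained b%:Z).
    * by have := attained (- b%:Z); rewrite normrN rmorphN opprK; apply.
    (* [A_(n/2) = 2n - 2] is nonzero because [n > 2b > 2]. *)
    * apply/mem_dist_support/dist_distr_neq0; rewrite dU.
      have : (n%:R : rat) > 2%:R by rewrite ltr_nat; lia.
      lra.
    * apply/mem_dist_support; exists (hadamard_word H (Ordinal hn, 0)).
      exists (hadamard_word H (Ordinal hn, 0) + const_mx 1).
      split=> //; last by apply/eqP; rewrite eqr_nat hamming_eqn.
      by rewrite in_setU hadamard_code_compl ?mem_hadamard_word.
  + by exists (hadamard_code H), (hadamard_code K).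
Qed.
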